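(* Let $u^N(t,\frac xN)$ be the solution of $$\partial_tu=L^N_{a(t)}u+g(t,\tfrac xN)\quad\text{on }\tfrac1N\mathbb T_N^n,$$ with $a(t)\in\mathcal A(c_-,c_+)$ continuous in $t$, $g$ bounded and continuous in $t$, and initial value $u^N(0)$ with $\|u^N(0)\|_\infty<\infty$. Let $\sigma\in(0,1)$ be the Nash exponent. Then $$|u^N(t_1,\tfrac{x_1}N)-u^N(t_2,\tfrac{x_2}N)|\le C\big(\|g\|_\infty+\|u^N(0)\|_\infty\big)\frac{|t_2-t_1|^{\frac\sigma2}+|\frac{x_1}N-\frac{x_2}N|^\sigma}{(t_1\wedge t_2)^{\frac\sigma2}}$$ for $0<t_1,t_2\le T$ and $x_1,x_2\in\mathbb T_N^n$, where $C=C(n,c_\pm,T)$ (independent of $N$) and $\|g\|_\infty=\|g\|_{L^\infty([0,T]\times\frac1N\mathbb T_N^n)}$.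
   Context: Notation. $N\in\mathbb N$, $T>0$, $\mathbb T_N^n=(\mathbb Z/N\mathbb Z)^n$; functions on $\frac1N\mathbb T^n_N\subset\mathbb T^n=\mathbb R^n/\mathbb Z^n$ are written $u(\frac xN)$. $|\frac{x_1}N-\frac{x_2}N|$ is the Euclidean distance on the torus, $\min_{x_2'\equiv x_2\bmod N}|\frac{x_1}N-\frac{x_2'}N|$. For $0<c_-<c_+<\infty$, $\mathcal A(c_-,c_+)$ is the set of $a=\{a_{x,e}\}_{x\in\mathbb T_N^n,\,e\in\mathbb Z^n,|e|=1}$ with $a_{x,e}=a_{x+e,-e}$ and $c_-\le a_{x,e}\le c_+$. $L^N_au(\frac xN)=N^2\sum_{|e|=1}a_{x,e}\{u(\frac{x+e}N)-u(\frac xN)\}$. Nash exponent. $\sigma\in(0,1)$ denotes a fixed exponent for which there is $C=C(n,c_\pm)$ such that for every $N$, every $a(t)=\{a_{x,e}(t)\}_{x\in\mathbb Z^n,|e|=1}$ continuous in $t$ with $a_{x,e}=a_{x+e,-e}$ and $c_-\le a_{x,e}\le c_+$, and every bounded $u_0$ on $\frac1N\mathbb Z^n$, the bounded solution of $\partial_tu(t,\frac xN)=N^2\sum_{|e|=1}a_{x,e}(t)\{u(t,\frac{x+e}N)-u(t,\frac xN)\}$ on $\frac1N\mathbb Z^n$ with $u(0)=u_0$ satisfies $|u(t,\frac xN)-u(s,\frac yN)|\le C\|u_0\|_\infty\big(\frac{|t-s|^{1/2}\vee|\frac xN-\frac yN|}{(t\wedge s)^{1/2}}\big)^\sigma$ for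 all $t,s>0$, $x,y\in\mathbb Z^n$. Such an exponent exists by the Nash continuity estimate. *)

(* Defs.v *)
From HB Require Import structures.
From mathcomp Require Import all_boot all_order all_algebra.
From mathcomp Require Import all_classical all_reals all_analysis.

Set Implicit Arguments.
Unset Strict Implicit.
Unset Printing Implicit Defensive.

Import Order.TTheory GRing.Theory Num.Theory.
Import numFieldNormedType.Exports.

Local Open Scope classical_set_scope.
Local Open Scope ring_scope.

(* The 2n vectors e in Z^n with |e| = 1, as a finite type: (i, b) stands for
   (-1)^b times the i-th basis vector (see [unit_vecP] and [evec_inj]).  On a
   torus of side 1 or 2 distinct directions may induce the same translation
   but still contribute separate terms. *)
Definition dir (n : nat) : Type := ('I_n * bool)%type.

Definition evec (n : nat) (e : dir n) : 'rV[int]_n :=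
  (-1) ^+ e.2 *: delta_mx 0 e.1.

Definition dir_opp (n : nat) (e : dir n) : dir n := (e.1, ~~ e.2).

(* (Z/NZ)^n for the side N = M.+1, which makes side 0 impossible.  'I_M.+1 is
   the additive group Z/(M.+1)Z for every M, including the trivial group at
   M = 0 (unlike 'Z_1, which is Z/2Z). *)
Notation torus n M := 'rV['I_M.+1]_n.

Definition torus_proj (n M : nat) (z : 'rV[int]_n) : torus n M :=
  map_mx (fun k : int => Zp1 *~ k) z.

Definition torus_lift (n M : nat) (x : torus n M) : 'rV[int]_n :=
  map_mx (fun i : 'I_M.+1 => (i : nat)%:Z) x.

Definition enorm (R : realType) (n : nat) (v : 'rV[R]_n) : R :=
  Num.sqrt (\sum_(i < n) v 0 i ^+ 2).

(* The point z / N of (1/N) Z^n. *)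
Definition mesh (R : realType) (n N : nat) (z : 'rV[int]_n) : 'rV[R]_n :=
  N%:R^-1 *: map_mx intr z.

(* The infimum is a minimum: the representatives of [x2] form a discrete set. *)
Definition torus_dist (R : realType) (n M : nat) (x1 x2 : torus n M) : R :=
  inf [set enorm (mesh R M.+1 (torus_lift x1) - mesh R M.+1 z)
      | z in [set z : 'rV[int]_n | torus_proj M z = x2]].

(* Meaningful only when f is bounded on A ([sup] of an unbounded set is 0). *)
Definition supnorm (R : realType) (S : Type) (A : set S) (f : S -> R) : R :=
  sup [set `|f s| | s in A].

(* The lattice Z^n and the torus are treated uniformly, as an additive group V
   together with the projection p : Z^n -> V; the neighbour x + e of x is
   x + p (evec e), with p = id for Z^n itself.  A function u(x/N) on the
   rescaled lattice is encoded as a function of x. *)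
Section Operator.
Variables (R : realType) (n : nat) (V : zmodType) (p : 'rV[int]_n -> V).

Definition conductance (cm cp : R) (a : V -> dir n -> R) : Prop :=
  forall x e, a x e = a (x + p (evec e)) (dir_opp e) /\ cm <= a x e <= cp.

Definition Lop (N : nat) (a : V -> dir n -> R) (u : V -> R) (x : V) : R :=
  N%:R ^+ 2 * \sum_(e : dir n) a x e * (u (x + p (evec e)) - u x).

(* Classical solutions of du/dt = L_{a(t)} u + g on the time interval J:
   continuous on J, and satisfying the equation in the interior of J. *)
Definition solves (N : nat) (J : set R) (a : R -> V -> dir n -> R)
    (g u : R -> V -> R) : Prop :=
  (forall x, {within J, continuous (u ^~ x)}) /\
  (forall t x, J° t ->
     is_derive t 1 (u ^~ x) (Lop N (a t) (u t) x + g t x)).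

End Operator.

(* [sigma] is an admissible Nash exponent for (n, cm, cp). *)
Definition nash_exponent (R : realType) (n : nat) (cm cp sigma : R) : Prop :=
  0 < sigma < 1 /\
  exists C : R,
  forall (N : nat) (a : R -> 'rV[int]_n -> dir n -> R)
         (u : R -> 'rV[int]_n -> R),
  (0 < N)%N ->
  (forall t, 0 <= t -> conductance id cm cp (a t)) ->
  (forall x e, {within `[0, +oo[, continuous (fun t => a t x e)}) ->
  solves id N `[0, +oo[ a (fun _ _ => 0) u ->
  [bounded u q.1 q.2 | q in `[0, +oo[ `*` setT] ->
  forall (t s : R) (x y : 'rV[int]_n), 0 < t -> 0 < s ->
  `|u t x - u s y| <=
    C * supnorm setT (u 0)
      * (Num.max (Num.sqrt `|t - s|) (enorm (mesh R N x - mesh R N y))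
         / Num.sqrt (Num.min t s)) `^ sigma.

Lemma unit_vecP (n : nat) (z : 'rV[int]_n) :
  (\sum_(i < n) z 0 i ^+ 2 = 1) <-> exists e : dir n, z = evec e.
Proof.
split=> [h|[[i b] ->]]; last first.
  rewrite (bigD1 i)//= big1 ?addr0 => [|j ji].
    by rewrite !mxE !eqxx mulr1 -exprM mulnC exprM sqrrN !expr1n.
  by rewrite !mxE (negbTE ji) andbF mulr0 expr0n.
have [i zi] : exists i, z 0 i != 0.
  apply/existsP; apply: contraPT h => /existsPn h.
  by rewrite big1// => i _; move: (h i); rewrite negbK => /eqP ->.
have sq1 : 1 <= z 0 i ^+ 2.
  by rewrite -gtz0_ge1 exprn_even_gt0//= zi.
move: h; rewrite (bigD1 i)//= => h.
have s0 : \sum_(j < n | j != i) z 0 j ^+ 2 = 0.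
  apply/eqP; rewrite eq_le; apply/andP; split.
    by rewrite -(lerD2l (z 0 i ^+ 2)) h addr0.
  by apply: sumr_ge0 => j _; exact: sqr_ge0.
have zj j : j != i -> z 0 j = 0.
  move=> ji; apply/eqP; rewrite -sqrf_eq0.
  move/eqP: s0; rewrite psumr_eq0 => [/allP/(_ j)|k _]; last exact: sqr_ge0.
  by rewrite mem_index_enum ji => /(_ isT).
move: h; rewrite s0 addr0 => /eqP; rewrite sqrf_eq1 => /orP zi1.
exists (i, z 0 i == -1); apply/rowP => j; rewrite !mxE eqxx /=.
have [->|ji] := eqVneq j i; last by rewrite mulr0 zj.
by case: zi1 => /eqP ->; rewrite ?mulr1.
Qed.

Lemma evec_inj (n : nat) : injective (@evec n).
Proof.
move=> [i b] [j c] /rowP/(_ i); rewrite !mxE !eqxx /=.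
have [->|_] := eqVneq i j; first by case: b; case: c.
by case: b; case: c.
Qed.

Lemma Zp1_mulrn (M m : nat) : (Zp1 *+ m : 'I_M.+1) = inZp m.
Proof. by rewrite Zp_mulrn; apply: val_inj; rewrite /= modnMml mul1n. Qed.

Lemma torus_projP (n M : nat) (y z : 'rV[int]_n) :
  torus_proj M y = torus_proj M z <->
  forall i, (y ord0 i = z ord0 i %[mod M.+1])%Z.
Proof.
have Zp1_eq0 (d : int) : ((Zp1 *~ d : 'I_M.+1) == 0) = (M.+1 %| d)%Z.
  have Zp1n m : ((Zp1 *+ m : 'I_M.+1) == 0) = (M.+1 %| m)%N.
    by rewrite Zp1_mulrn -val_eqE.
  by case: d => m; rewrite ?NegzE ?mulrNz ?oppr_eq0 -pmulrn Zp1n ?dvdzE ?abszN.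
have E i : (Zp1 *~ y 0 i == Zp1 *~ z 0 i :> 'I_M.+1) =
           (y ord0 i == z ord0 i %[mod M.+1])%Z.
  by rewrite eqz_mod_dvd -Zp1_eq0 mulrzBr subr_eq0.
split=> [/rowP h i|h].
  by apply/eqP; rewrite -E; apply/eqP; have := h i; rewrite !mxE.
by apply/rowP => i; rewrite !mxE; apply/eqP; rewrite E; apply/eqP.
Qed.

Lemma torus_liftK (n M : nat) : cancel (@torus_lift n M) (@torus_proj n M).
Proof.
move=> x; apply/rowP => i; rewrite !mxE -pmulrn Zp1_mulrn.
exact: valZpK.
Qed.

(* Main.v *)
(* Duhamel's formula in dual form. For a space-time point (t, x), let q solve the
   backward homogeneous equation ending at the Dirac mass in x at time t. As the
   operator is self-adjoint, pairing q(s) with a forward homogeneous solution is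
   constant in s, while F(s) = sum_y q(s, y) u(s, y) satisfies
   F'(s) = sum_y q(s, y) g(s, y), which is the value at (t, x) of the homogeneous
   solution started from g(s) at time s. The Nash estimate and the maximum principle
   bound the derivative of the difference of two such F by a multiple of
   (t1 - s)^(- sigma / 2), which is integrable; the mean value inequality concludes.
   Homogeneous solutions on the torus are lifted to periodic ones on Z^n in order to
   apply the Nash estimate. *)
Require Import Defs.
From HB Require Import structures.
From mathcomp Require Import all_boot all_order all_algebra.
From mathcomp Require Import all_classical all_reals all_analysis.
From mathcomp Require Import ring lra.

Set Implicit Arguments.
Unset Strict Implicit.
Unset Printing Implicit Defensive.

Import Order.TTheory GRing.Theory Num.Theory.
Import numFieldNormedType.Exports.

Local Open Scope classical_set_scope.
Local Open Scope ring_scope.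

(** * Calculus *)

(** Both [h - f] and [h + f] have nonnegative derivatives, so neither decreases from [a] to [b].
    Derivatives are asked for only in the open interval, which admits an [h] with infinite slope at
    [b]. *)
Lemma mean_value_bound (R : realType) (f h df dh : R -> R) (a b : R) :
  a <= b ->
  (forall t, a < t < b -> is_derive t 1 f (df t)) ->
  (forall t, a < t < b -> is_derive t 1 h (dh t)) ->
  (forall t, a < t < b -> `|df t| <= dh t) ->
  {within `[a, b], continuous f} -> {within `[a, b], continuous h} ->
  `|f b - f a| <= h b - h a.
Proof.
rewrite le_eqVlt => /predU1P[->|ab] f' h' fh cf ch; first by rewrite !subrr normr0.
have [c1 c1ab E1] : exists2 c, c \in `]a, b[%R &
    (h b - f b) - (h a - f a) = (dh c - df c) * (b - a).
  apply: (@MVT _ (fun t => h t - f t) (fun t => dh t - df t)) => //.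
    move=> x; rewrite in_itv/= => xab.
    by apply: is_deriveB; [exact: h'|exact: f'].
  by move=> x; apply: cvgB; [exact: ch|exact: cf].
have [c2 c2ab E2] : exists2 c, c \in `]a, b[%R &
    (h b + f b) - (h a + f a) = (dh c + df c) * (b - a).
  apply: (@MVT _ (fun t => h t + f t) (fun t => dh t + df t)) => //.
    move=> x; rewrite in_itv/= => xab.
    by apply: is_deriveD; [exact: h'|exact: f'].
  by move=> x; apply: cvgD; [exact: ch|exact: cf].
have := fh _ c1ab; have := fh _ c2ab.
rewrite !in_itv/= in c1ab c2ab.
rewrite !ler_norml => /andP[d1 d2] /andP[d3 d4].
have : 0 <= (dh c1 - df c1) * (b - a) by apply: mulr_ge0; lra.
have : 0 <= (dh c2 + df c2) * (b - a) by apply: mulr_ge0; lra.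
by rewrite -E1 -E2; lra.
Qed.

Lemma derive0_eq (R : realType) (f : R -> R) (a b : R) :
  a <= b -> (forall t, a < t < b -> is_derive t 1 f 0) ->
  {within `[a, b], continuous f} -> f b = f a.
Proof.
move=> ab f' cf.
apply/eqP; rewrite -subr_eq0 -normr_le0 -(subrr (0 : R)).
apply: (@mean_value_bound _ f (cst 0) (cst 0) (cst 0)) => //.
- by move=> t _; rewrite normr0.
- by apply: continuous_subspaceT => t; exact: cst_continuous.
Qed.

Lemma antiderivative (R : realType) (h : R -> R) : continuous h ->
  exists F : R -> R, F 0 = 0 /\ forall t : R, 0 <= t -> is_derive t 1 F (h t).
Proof.
move=> ch.
(* Integrating from -1 makes 0 an interior point, so that the derivative at 0 is two-sided. *)
pose G x := (\int[@lebesgue_measure R]_(t in `[- 1, x]) h t)%R.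
exists (fun t => G t - G 0); split; first by rewrite subrr.
move=> t t0.
have [||||dG GE] := @continuous_FTC1_closed R h (- 1) t (t + 1).
- by rewrite ltrDl.
- apply: continuous_compact_integrable; first exact: segment_compact.
  exact: continuous_subspaceT.
- by lra.
- exact: ch.
rewrite -[h t]subr0; apply: is_deriveB.
by apply: DeriveDef => //; rewrite -GE derive1E.
Qed.

Lemma is_derive_continuous (R : realType) (f : R -> R) (t df : R) :
  is_derive t 1 f df -> {for t, continuous f}.
Proof.
by move=> [d _]; apply/differentiable_continuous/derivable1_diffP.
Qed.

Lemma continuous_clamp (R : realType) (a : R) (f : R -> R) :
  (forall t, a <= t -> {for t, continuous f}) ->
  continuous (fun t => f (Num.max t a)).
Proof.
move=> cf t; apply: (@continuous_comp _ _ _ (fun t => Num.max t a) f).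
  by apply: (@continuous_max _ _ id (cst a)); [exact: cvg_id|exact: cvg_cst].
by apply: cf; rewrite le_max lexx orbT.
Qed.

(** * Picard iteration on the half-line *)

Lemma geometric_small (R : realType) (x e : R) : 0 < e ->
  exists k, x * 2^-1 ^+ k < e.
Proof.
move=> e0; exists (Num.truncn (`|x| / e)).+1.
have k1 : `|x| / e < (Num.truncn (`|x| / e)).+1%:R by rewrite truncnS_gt.
set k := _.+1 in k1 *.
have k2 : k%:R < 2 ^+ k :> R by rewrite -natrX ltr_nat ltn_expl.
rewrite exprVn ltr_pdivrMr ?exprn_gt0//.
apply: le_lt_trans (ler_norm x) _.
by rewrite mulrC -ltr_pdivrMr//; apply: lt_trans k2.
Qed.

(** The derivative of [c / 2 * expR (2 * L * s)] is exactly [L * (c * expR (2 * L * s))]: the 2 in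
    the exponent yields the contraction factor 1/2. *)
Lemma expR_primitive_bound (R : realType) (F dF : R -> R) (L c t : R) :
  0 < L -> 0 <= c -> 0 <= t -> F 0 = 0 ->
  (forall s : R, 0 <= s -> is_derive s 1 F (dF s)) ->
  (forall s : R, 0 <= s -> `|dF s| <= L * (c * expR (2 * L * s))) ->
  `|F t| <= c / 2 * expR (2 * L * t).
Proof.
move=> L0 c0 t0 F0 F' dFb.
have := @mean_value_bound R F (fun s => c / 2 * expR (2 * L * s)) dF
  (fun s => L * (c * expR (2 * L * s))) 0 t t0.
rewrite F0 subr0 mulr0 expR0 mulr1 => H; apply: le_trans.
- apply: H => //.
  + by move=> s /andP[/ltW s0 _]; exact: F'.
  + move=> s _; apply: is_derive_eq.
    by rewrite /GRing.scale/=; field.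
  + by move=> s /andP[/ltW s0 _]; exact: dFb.
  + apply: continuous_in_subspaceT => s; rewrite inE/= in_itv/= => /andP[s0 _].
    exact: is_derive_continuous (F' _ s0).
  + apply: continuous_subspaceT => s.
    have : is_derive s 1 (fun s => c / 2 * expR (2 * L * s)) (L * (c * expR (2 * L * s))).
      by apply: is_derive_eq; rewrite /GRing.scale/=; field.
    exact: is_derive_continuous.
- by rewrite gerBl divr_ge0.
Qed.

(* Iterates are evaluated at [max t 0], so that they are continuous on the whole
   line; the weight exp(2 L t) makes the Picard map a contraction of ratio 1/2
   on the whole half-line. *)
Lemma picard_lindelof (R : realType) (I : Type) (B : R -> (I -> R) -> I -> R)
    (L K0 : R) (w0 : I -> R) :
  0 < L -> 0 <= K0 ->
  (forall t (f h : I -> R) K, (forall i, `|f i - h i| <= K) ->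
     forall i, `|B t f i - B t h i| <= L * K) ->
  (forall U : R -> I -> R, (forall i, continuous (U ^~ i)) ->
     forall i, continuous (fun t => B t (U t) i)) ->
  (forall t i, `|B t w0 i| <= L * K0) ->
  exists w : R -> I -> R, w 0 = w0 /\
    forall (t : R) i, 0 <= t -> is_derive t 1 (w ^~ i) (B t (w t) i).
Proof.
move=> L0 K00 BL Bc Bw0.
(* [P] chooses, for every continuous function, an antiderivative vanishing at 0. *)
have [h|P HP] := boolp.choice (P := fun (h F : R -> R) => continuous h -> F 0 = 0 /\
    forall t : R, 0 <= t -> is_derive t 1 F (h t)).
  have [/antiderivative[F FP]|nch] := pselect (continuous h); first by exists F.
  by exists h => /nch.
pose pos (t : R) := Num.max t 0.
have pos_ge0 t : 0 <= pos t by rewrite le_max lexx orbT.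
have posE t : 0 <= t -> pos t = t by move=> t0; rewrite /pos; apply: max_idPl.
pose E t : R := expR (2 * L * pos t).
have E0 t : 0 < E t by exact: expR_gt0.
pose S (U : R -> I -> R) t i := w0 i + P (fun s => B s (U s) i) (pos t).
pose W k := iter k S (fun=> w0).
have S_cont U : (forall i, continuous (U ^~ i)) -> forall i, continuous (S U ^~ i).
  move=> cU i; apply: (@continuous_clamp _ 0 (fun t => w0 i + P (fun s => B s (U s) i) t)).
  move=> t t0; apply: cvgD; first exact: cvg_cst.
  apply: is_derive_continuous (proj2 (HP _ (Bc _ cU i)) _ t0).
have W_cont k i : continuous (W k ^~ i).
  elim: k i => [i|k IH i]; first by move=> t; exact: cvg_cst.
  exact: S_cont.
have S_contract U U' c : 0 <= c ->
    (forall i, continuous (U ^~ i)) -> (forall i, continuous (U' ^~ i)) ->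
    (forall t i, `|U t i - U' t i| <= c * E t) ->
    forall t i, `|S U t i - S U' t i| <= c / 2 * E t.
  move=> c0 cU cU' UU' t i; rewrite /S opprD addrACA subrr add0r.
  have [P0 P'] := HP _ (Bc _ cU i); have [Q0 Q'] := HP _ (Bc _ cU' i).
  apply: (@expR_primitive_bound _
    (fun t => P (fun s => B s (U s) i) t - P (fun s => B s (U' s) i) t)
    (fun s => B s (U s) i - B s (U' s) i)) => //.
  - by rewrite P0 Q0 subr0.
  - by move=> s s0; apply: is_deriveB; [exact: P'|exact: Q'].
  - by move=> s s0; apply: BL => j; rewrite -{3}(posE _ s0); exact: UU'.
have W_step k t i : `|W k.+1 t i - W k t i| <= K0 * 2^-1 ^+ k * E t.
  elim: k t i => [t i|k IH t i].
    rewrite /W/= /S addrC addKr expr0 mulr1.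
    have [P0 P'] := HP _ (Bc _ (W_cont 0%N) i).
    apply: le_trans (@expR_primitive_bound _ (P (fun s => B s (W 0%N s) i))
      (fun s => B s (W 0%N s) i) L K0 (pos t) L0 K00 _ P0 P' _) _ => //.
      move=> s s0; apply: le_trans (Bw0 _ _) _.
      rewrite ler_pM2l// ler_peMr// -expR0 ler_expR.
      by rewrite mulr_ge0// mulr_ge0// ltW.
    by apply: ler_wpM2r; [exact/ltW/E0|lra].
  have c0 : 0 <= K0 * 2^-1 ^+ k by rewrite mulr_ge0// exprn_ge0.
  have := S_contract _ _ _ c0 (W_cont k.+1) (W_cont k) IH t i.
  by rewrite exprSr mulrA.
(* The increments from rank [k] on add up to at most [2 * K0 * 2^-1 ^+ k * E t]. Hence the intervals
   from [lo] to [hi] are nested around the limit, which is taken as the supremum of the lower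
   ends. *)
pose lo t i k := W k t i - 2 * K0 * 2^-1 ^+ k * E t.
pose hi t i k := W k t i + 2 * K0 * 2^-1 ^+ k * E t.
have lohi t i k : lo t i k <= hi t i k.
  by rewrite lerD2l ge0_cp// !mulr_ge0// ?exprn_ge0// ltW.
have lo_nd t i : nondecreasing_seq (lo t i).
  apply/nondecreasing_seqP => k; rewrite /lo.
  have := W_step k t i; rewrite ler_norml exprS.
  set z := 2^-1 ^+ k; lra.
have hi_ni t i : nonincreasing_seq (hi t i).
  apply/nonincreasing_seqP => k; rewrite /hi.
  have := W_step k t i; rewrite ler_norml exprS.
  set z := 2^-1 ^+ k; lra.
have lo_hi t i j k : lo t i j <= hi t i k.
  apply: le_trans (lo_nd t i _ _ (leq_maxl j k)) _.
  apply: le_trans (lohi _ _ _) _.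
  exact: hi_ni (leq_maxr j k).
pose U t i := sup (range (lo t i)).
have U_near k t i : `|U t i - W k t i| <= 2 * K0 * 2^-1 ^+ k * E t.
  have h1 : U t i <= hi t i k.
    by apply: ge_sup; [exists (lo t i 0%N), 0%N|move=> _ [j _ <-]].
  have h2 : lo t i k <= U t i.
    apply: ub_le_sup; last by exists k.
    by exists (hi t i 0%N) => _ [j _ <-].
  by rewrite ler_norml; move: h1 h2; rewrite /hi /lo; lra.
have U_cont i : continuous (U ^~ i).
  (* Three-epsilon argument: [M] bounds the weight [E] at distance less than 1 from [t], so the
     convergence is uniform there. *)
  move=> t; apply/cvgrPdist_lt => e e0.
  pose M := expR (2 * L * (pos t + 1)).
  have [k ke] := geometric_small (2 * K0 * M) (divr_gt0 e0 (ltr0n R 3)).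
  have EM s : `|t - s| < 1 -> E s <= M.
    move=> ts; rewrite ler_expR ler_pM2l ?mulr_gt0//.
    have tp : t <= pos t by rewrite le_max lexx.
    have := pos_ge0 t; move: ts; rewrite {2}/pos ge_max ltr_norml; lra.
  have /cvgrPdist_lt/(_ _ (divr_gt0 e0 (ltr0n R 3))) := W_cont k i t.
  have := @nbhsx_ballx _ R t 1 ltr01.
  apply: filterS2 => s /= /EM Es Ws.
  have Et : E t <= M by apply: EM; rewrite subrr normr0.
  have h s' : E s' <= M -> `|U s' i - W k s' i| < e / 3.
    move=> Es'; apply: le_lt_trans (U_near k s' i) _; apply: le_lt_trans ke.
    rewrite mulrAC ler_wpM2r ?exprn_ge0//.
    by rewrite ler_wpM2l// mulr_ge0.
  have := h _ Es; have := h _ Et; move: Ws.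
  rewrite !ltr_norml; lra.
(* Unlike [S U], the function [w] does not clamp the time, so it has a two-sided derivative at 0 as
   well. *)
pose w t i := w0 i + P (fun s => B s (U s) i) t.
have wU t : 0 <= t -> w t = U t.
  move=> t0; apply/funext => i.
  have -> : w t i = S U t i by rewrite /S posE.
  (* [S U] and [U] both lie within [K0 * 2^-1 ^+ k * E t] of [W k.+1] for every [k], which excludes
     a positive distance. *)
  apply/eqP; rewrite -subr_eq0 -normr_le0 leNgt; apply/negP => d0.
  have [k] := geometric_small (2 * K0 * E t) d0.
  apply/negP; rewrite -leNgt.
  have h1 : `|S U t i - W k.+1 t i| <= 2 * K0 * 2^-1 ^+ k / 2 * E t.
    by apply: S_contract => //; rewrite !mulr_ge0// exprn_ge0.
  have h2 := U_near k.+1 t i.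
  apply: le_trans (ler_distD (W k.+1 t i) _ _) _.
  rewrite [X in _ + X]distrC; apply: le_trans (lerD h1 h2) _.
  rewrite exprS; set z := 2^-1 ^+ k; lra.
exists w; split.
  by apply/funext => i; rewrite /w (proj1 (HP _ (Bc _ U_cont i))) addr0.
move=> t i t0; rewrite (wU _ t0) -[B _ _ _]add0r.
by apply: is_deriveD; exact: (proj2 (HP _ (Bc _ U_cont i))).
Qed.

(** * Linear equations on lattices *)

Lemma sum_continuous (R : realType) (T : topologicalType) (I : Type)
    (r : seq I) (f : I -> T -> R) :
  (forall i, continuous (f i)) -> continuous (fun t => \sum_(i <- r) f i t).
Proof.
move=> cf t; elim: r => [|i r IH].
  under eq_fun do rewrite big_nil; exact: cvg_cst.
under eq_fun do rewrite big_cons.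
by apply: cvgD; [exact: cf|exact: IH].
Qed.

Lemma is_derive_bigsum (R : realType) (I : Type) (r : seq I)
    (f : I -> R -> R) (df : I -> R) (t : R) :
  (forall i, is_derive t 1 (f i) (df i)) ->
  is_derive t 1 (fun t => \sum_(i <- r) f i t) (\sum_(i <- r) df i).
Proof.
move=> f'; elim: r => [|i r IH].
  rewrite big_nil; under eq_fun do rewrite big_nil; exact: is_derive_cst.
rewrite big_cons; under eq_fun do rewrite big_cons.
exact: is_deriveD.
Qed.

Section LatticeODE.
Variables (R : realType) (n : nat) (V : zmodType) (p : 'rV[int]_n -> V).
Variables (N : nat) (cm cp : R).
Hypothesis cm0 : 0 < cm.

Lemma Lop_lipschitz (a : V -> dir n -> R) (f h : V -> R) (K : R) :
  conductance p cm cp a -> (forall x, `|f x - h x| <= K) ->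
  forall x, `|Lop p N a f x - Lop p N a h x| <=
    N%:R ^+ 2 * (#|{: dir n}|%:R * (cp * (2 * K))).
Proof.
move=> ha fh x; rewrite /Lop -mulrBr -sumrB normrM ger0_norm ?exprn_ge0//.
apply: ler_wpM2l; first exact: exprn_ge0.
apply: le_trans (ler_norm_sum _ _ _) _.
rewrite mulr_natl -sumr_const; apply: ler_sum => e _.
have [_ /andP[ac aC]] := ha x e.
rewrite -mulrBr normrM; apply: ler_pM => //.
  by rewrite ger0_norm//; apply: le_trans ac; exact: ltW.
have := fh x; have := fh (x + p (evec e)); rewrite !ler_norml; lra.
Qed.

(** The operator is Lipschitz for the sup norm, uniformly in time, so Picard iteration applies even
    on an infinite [V]. *)
Lemma lattice_solution (a : R -> V -> dir n -> R) (s K : R) (f : V -> R) :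
  0 <= cp ->
  (forall t, conductance p cm cp (a t)) ->
  (forall x e, continuous (fun t => a t x e)) ->
  (forall x, `|f x| <= K) ->
  exists v : R -> V -> R, v s = f /\
    forall (t : R) x, s <= t -> is_derive t 1 (v ^~ x) (Lop p N (a t) (v t) x).
Proof.
move=> cp0 ha ca fK.
have K0 : 0 <= K by apply: le_trans (fK 0).
(* The summand 1 keeps [L] positive even when [N] or [n] is 0. *)
pose L : R := N%:R ^+ 2 * (#|{: dir n}|%:R * (cp * 2)) + 1.
have L1 : 1 <= L by rewrite lerDr !mulr_ge0.
have [||||w [w0 w']] := @picard_lindelof R V
    (fun t => Lop p N (a (s + t))) L K f _ K0.
- exact: lt_le_trans L1.
- move=> t f' h K' fh x.
  have K'0 : 0 <= K' by apply: le_trans (fh 0).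
  apply: le_trans (Lop_lipschitz (ha _) fh x) _.
  by rewrite /L; lra.
- move=> U cU x t; apply: cvgM; first exact: cvg_cst.
  apply: (@sum_continuous _ _ _ _ (fun e t => a (s + t) x e * (U t (x + p (evec e)) - U t x))).
  move=> e t'; apply: cvgM; last by apply: cvgB; exact: cU.
  apply: (@continuous_comp _ _ _ (fun t => s + t) (fun t => a t x e)); last exact: ca.
  by apply: cvgD; [exact: cvg_cst|exact: cvg_id].
(* The operator vanishes on the zero function, so the Lipschitz bound also controls its value at
   [f]. *)
- move=> t x; have := @Lop_lipschitz (a (s + t)) f (fun=> 0) K (ha _) _ x.
  have -> : Lop p N (a (s + t)) (fun=> 0) x = 0.
    by rewrite /Lop big1 ?mulr0// => e _; rewrite subrr mulr0.
  rewrite subr0 => H; apply: le_trans (H _) _.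
    by move=> y; rewrite subr0.
  by rewrite /L; lra.
exists (fun t => w (t - s)); split; first by rewrite subrr.
move=> t x st; have ts0 : 0 <= t - s by rewrite subr_ge0.
have w't := w' _ x ts0.
have -> : a t = a (s + (t - s)) by rewrite addrC subrK.
have d : is_derive t 1 (fun t => t - s) 1.
  by apply: is_derive_eq; rewrite subr0.
have := @is_derive1_comp R (w ^~ x) (fun t => t - s) t _ _ w't d.
by rewrite mulr1.
Qed.

(** Reversing time turns this into the forward equation with coefficients [a (- t)]. *)
Lemma lattice_backward_solution (a : R -> V -> dir n -> R) (s K : R) (f : V -> R) :
  0 <= cp ->
  (forall t, conductance p cm cp (a t)) ->
  (forall x e, continuous (fun t => a t x e)) ->
  (forall x, `|f x| <= K) ->
  exists q : R -> V -> R, q s = f /\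
    forall (t : R) x, t <= s -> is_derive t 1 (q ^~ x) (- Lop p N (a t) (q t) x).
Proof.
move=> cp0 ha ca fK.
have opp_cont : continuous (fun t : R => - t) by move=> t; exact: opp_continuous.
have [|x e t||w [w0 w']] := @lattice_solution (fun t => a (- t)) (- s) K f cp0.
- by move=> t; exact: ha.
- apply: (@continuous_comp _ _ _ (fun t : R => - t) (fun t => a t x e)); last exact: ca.
  exact: opp_cont.
- exact: fK.
exists (fun t => w (- t)); split; first exact: w0.
move=> t x ts; have ts' : - s <= - t by rewrite lerN2.
have := w' _ x ts'; rewrite opprK => w't.
have d : is_derive t 1 (fun t : R => - t) (- 1).
  by apply: is_derive_eq.
by have := @is_derive1_comp R (w ^~ x) (fun t : R => - t) t _ _ w't d; rewrite mulrN1.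
Qed.

End LatticeODE.

(** * Summation by parts and the maximum principle on a finite lattice *)

Section FiniteLattice.
Variables (R : realType) (n : nat) (V : finZmodType) (p : 'rV[int]_n -> V).
Variables (N : nat) (cm cp : R).
Hypothesis cm0 : 0 < cm.
Hypothesis pN : forall e, p (evec (dir_opp e)) = - p (evec e).

(** Reversing the orientation permutes the oriented edges. *)
Lemma sum_edge_flip (F : V -> dir n -> R) :
  \sum_x \sum_e F x e = \sum_x \sum_e F (x + p (evec e)) (dir_opp e).
Proof.
have oppK : involutive (@dir_opp n) by case=> i b; rewrite /dir_opp/= negbK.
rewrite exchange_big [RHS]exchange_big/= (reindex_inj (inv_inj oppK)).
apply: eq_bigr => e _; rewrite (reindex_inj (addIr (p (evec e)))).
by [].
Qed.

(** Summation by parts; the right-hand side is the Dirichlet form. Averaging the sum with its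
    edge-reversed copy produces the differences of [f] and accounts for the factor 1/2. *)
Lemma Lop_dirichlet (a : V -> dir n -> R) (f h : V -> R) :
  conductance p cm cp a ->
  \sum_x f x * Lop p N a h x = - (N%:R ^+ 2 / 2 * \sum_x \sum_e
    a x e * (f (x + p (evec e)) - f x) * (h (x + p (evec e)) - h x)).
Proof.
move=> ha; set s := LHS; set d := (X in - (_ * X)).
pose F x e := a x e * f x * (h (x + p (evec e)) - h x).
have sE : s = N%:R ^+ 2 * \sum_x \sum_e F x e.
  rewrite /s mulr_sumr; apply: eq_bigr => x _.
  rewrite /Lop mulrCA; congr (_ * _); rewrite mulr_sumr; apply: eq_bigr => e _.
  by rewrite /F mulrCA mulrA.
have dE : d = - (2 * \sum_x \sum_e F x e).
  rewrite mulr_natl mulr2n {2}sum_edge_flip -big_split -sumrN/=.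
  apply: eq_bigr => x _; rewrite -big_split -sumrN/=.
  apply: eq_bigr => e _.
  have [aE _] := ha x e.
  by rewrite /F -aE pN addrK; ring.
by rewrite sE dE; field.
Qed.

Lemma Lop_selfadjoint (a : V -> dir n -> R) (f h : V -> R) :
  conductance p cm cp a ->
  \sum_x f x * Lop p N a h x = \sum_x Lop p N a f x * h x.
Proof.
move=> ha; rewrite [RHS](eq_bigr (fun x => h x * Lop p N a f x)); last first.
  by move=> x _; rewrite mulrC.
rewrite !Lop_dirichlet//; congr (- (_ * _)).
by apply: eq_bigr => x _; apply: eq_bigr => e _; rewrite mulrAC.
Qed.

(** The exponential sum [S] replaces the spatial maximum, which need not be differentiable in time.
    Its derivative is minus a Dirichlet form pairing the increments of [expR (l * v)] with those of
    [v]; these have the same sign, so [S] does not increase. *)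
Lemma lattice_le_max (a : R -> V -> dir n -> R) (v : R -> V -> R) (s K : R) :
  (forall t, conductance p cm cp (a t)) ->
  (forall (t : R) x, s <= t -> is_derive t 1 (v ^~ x) (Lop p N (a t) (v t) x)) ->
  (forall x, v s x <= K) -> forall t x, s <= t -> v t x <= K.
Proof.
move=> ha v' vK t x st; rewrite leNgt; apply/negP => Kv.
(* This makes [l * (v t x - K)] equal to [#|V|], so that comparing [S t] with [S s] ends in exp(m)
   <= m for [m = #|V|], against exp(m) >= 1 + m. *)
pose l : R := #|V|%:R / (v t x - K).
have V0 : (0 < #|V|%:R :> R) by rewrite ltr0n; apply/card_gt0P; exists x.
have l0 : 0 < l by rewrite divr_gt0// subr_gt0.
pose S (t : R) := \sum_y expR (l * v t y).
pose dS t := \sum_y l * (expR (l * v t y) * Lop p N (a t) (v t) y).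
have S' r : s <= r -> is_derive r 1 S (dS r).
  move=> sr; apply: is_derive_bigsum => y.
  have v'r := v' r y sr.
  have d : is_derive r 1 (fun r => l * v r y) (l * Lop p N (a r) (v r) y).
    exact: is_deriveZ.
  have := @is_derive1_comp R expR (fun r => l * v r y) r _ _ (is_derive_expR _) d.
  by rewrite mulrCA.
have dS0 r : dS r <= 0.
  rewrite /dS -mulr_sumr Lop_dirichlet// mulrN oppr_le0 mulr_ge0 ?(ltW l0)//.
  rewrite mulr_ge0 ?divr_ge0 ?exprn_ge0//.
  apply: sumr_ge0 => y _; apply: sumr_ge0 => e _.
  have [_ /andP[ac _]] := ha r y e.
  rewrite -mulrA; apply: mulr_ge0; first exact: le_trans (ltW cm0) ac.
  have [h|h] := leP (v r y) (v r (y + p (evec e))).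
    by rewrite mulr_ge0// subr_ge0// ler_expR ler_pM2l.
  by rewrite mulr_le0// subr_le0 ?ler_expR ?ler_pM2l// ltW.
have St : S t <= S s.
  (* With the zero function on the left, the mean value bound says that [- S] does not decrease. *)
  have : `|cst (0 : R) t - cst (0 : R) s| <= - S t - - S s.
    apply: (@mean_value_bound _ (cst 0) (fun r => - S r) (cst 0)
      (fun r => - dS r) s t st).
    - by move=> r /andP[/ltW sr _]; apply: is_deriveN; exact: S'.
    - by move=> r _; rewrite normr0 oppr_ge0.
    - by apply: continuous_subspaceT => r; exact: cst_continuous.
    - apply: continuous_in_subspaceT => r; rewrite inE/= in_itv/= => /andP[sr _].
      exact/is_derive_continuous/is_deriveN/S'.
  by rewrite /cst/= subrr normr0; lra.
have St1 : expR (l * v t x) <= S t.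
  rewrite /S (bigD1 x)//= lerDl; apply: sumr_ge0 => y _; exact: expR_ge0.
have Ss : S s <= #|V|%:R * expR (l * K).
  rewrite mulr_natl -sumr_const; apply: ler_sum => y _.
  by rewrite ler_expR ler_pM2l.
have : expR (l * (v t x - K)) <= #|V|%:R.
  rewrite mulrBr expRB ler_pdivrMr ?expR_gt0//.
  by apply: le_trans St1 _; apply: le_trans Ss.
apply/negP; rewrite -ltNge; apply: lt_le_trans (expR_ge1Dx _).
by rewrite /l divfK ?subr_eq0 ?gt_eqF// ltrDr.
Qed.

Lemma lattice_max_principle (a : R -> V -> dir n -> R) (v : R -> V -> R) (s K : R) :
  (forall t, conductance p cm cp (a t)) ->
  (forall (t : R) x, s <= t -> is_derive t 1 (v ^~ x) (Lop p N (a t) (v t) x)) ->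
  (forall x, `|v s x| <= K) -> forall t x, s <= t -> `|v t x| <= K.
Proof.
move=> ha v' vK t x st; rewrite ler_norml lerNl; apply/andP; split.
  apply: (@lattice_le_max a (fun t x => - v t x) s K) => // [r y sr|y].
    have v'r := v' r y sr.
    have -> : Lop p N (a r) (fun x => - v r x) y = - Lop p N (a r) (v r) y.
      rewrite /Lop -mulrN -sumrN; congr (_ * _); apply: eq_bigr => e _.
      by rewrite -opprD mulrN.
    exact: is_deriveN.
  by have := vK y; rewrite ler_norml lerNl => /andP[].
apply: (@lattice_le_max a v s K) => // y.
by have := vK y; rewrite ler_norml => /andP[].
Qed.

(* With a backward solution [q] as test function, the operators cancel. *)
Lemma lattice_pairing_derive (a : R -> V -> dir n -> R) (q v : R -> V -> R)
    (g : V -> R) (t : R) :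
  conductance p cm cp (a t) ->
  (forall x, is_derive t 1 (q ^~ x) (- Lop p N (a t) (q t) x)) ->
  (forall x, is_derive t 1 (v ^~ x) (Lop p N (a t) (v t) x + g x)) ->
  is_derive t 1 (fun t => \sum_x q t x * v t x) (\sum_x q t x * g x).
Proof.
move=> ha q' v'.
have d : is_derive t 1 (fun t => \sum_x q t x * v t x)
    (\sum_x (q t x * (Lop p N (a t) (v t) x + g x)
             + v t x * - Lop p N (a t) (q t) x)).
  apply: is_derive_bigsum => x; have := q' x; have := v' x => ? ?.
  exact: is_deriveM.
apply: (is_derive_eq d).
rewrite (eq_bigr (fun x => q t x * Lop p N (a t) (v t) x
   - Lop p N (a t) (q t) x * v t x + q t x * g x)); last by move=> x _; ring.
by rewrite big_split/= sumrB -Lop_selfadjoint// subrr add0r.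
Qed.

End FiniteLattice.

(** * The Nash estimate on the torus *)

(** [q] is the transition kernel seen from [(r, x0)]: the pairing is constant on [[s, r]], and at
    time [r] the Dirac mass evaluates [v]. *)
Lemma lattice_duality (R : realType) (n : nat) (V : finZmodType)
    (p : 'rV[int]_n -> V) (N : nat) (cm cp : R) (a : R -> V -> dir n -> R)
    (q v : R -> V -> R) (s r : R) (x0 : V) :
  (forall e, p (evec (dir_opp e)) = - p (evec e)) ->
  (forall t, conductance p cm cp (a t)) ->
  q r = (fun x => (x == x0)%:R) ->
  (forall (t : R) x, t <= r -> is_derive t 1 (q ^~ x) (- Lop p N (a t) (q t) x)) ->
  (forall (t : R) x, s <= t -> is_derive t 1 (v ^~ x) (Lop p N (a t) (v t) x)) ->
  s <= r -> \sum_x q s x * v s x = v r x0.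
Proof.
move=> pN ha qr q' v' sr.
have d t : s <= t -> t <= r -> is_derive t 1 (fun t => \sum_x q t x * v t x) 0.
  move=> st tr.
  have v't x : is_derive t 1 (v ^~ x) (Lop p N (a t) (v t) x + 0).
    by rewrite addr0; exact: v'.
  have := @lattice_pairing_derive _ _ _ _ N _ _ pN a q v (fun=> 0) t (ha t)
    (fun x => q' t x tr) v't.
  by under eq_bigr do rewrite mulr0; rewrite big1.
transitivity (\sum_x q r x * v r x); last first.
  rewrite qr (bigD1 x0)//= eqxx mul1r big1 ?addr0// => x /negbTE ->.
  by rewrite mul0r.
apply/esym; apply: (@derive0_eq _ (fun t => \sum_x q t x * v t x) s r sr).
- by move=> t /andP[/ltW st /ltW tr]; exact: d.
- apply: continuous_in_subspaceT => t; rewrite inE/= in_itv/= => /andP[st tr].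
  exact: is_derive_continuous (d _ st tr).
Qed.

Lemma torus_projD (n M : nat) (y z : 'rV[int]_n) :
  torus_proj M (y + z) = torus_proj M y + torus_proj M z.
Proof. by apply/rowP => i; rewrite !mxE mulrzDr. Qed.

Lemma torus_proj_dir_opp (n M : nat) (e : dir n) :
  torus_proj M (evec (dir_opp e)) = - torus_proj M (evec e).
Proof.
apply/rowP => i; rewrite !mxE -mulrNz; congr (_ *~ _).
by case: e => j b; rewrite /dir_opp/= signrN mulNr.
Qed.

Lemma enormC (R : realType) (n : nat) (x y : 'rV[R]_n) :
  enorm (x - y) = enorm (y - x).
Proof.
congr Num.sqrt; apply: eq_bigr => i _.
by rewrite !mxE -sqrrN opprB.
Qed.

Lemma supnorm_le (R : realType) (S : Type) (A : set S) (f : S -> R) (K : R) :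
  A !=set0 -> (forall x, A x -> `|f x| <= K) -> supnorm A f <= K.
Proof.
move=> [x Ax] fK; apply: ge_sup; first by exists `|f x|, x.
by move=> _ [y Ay <-]; exact: fK.
Qed.

Lemma le_supnorm (R : realType) (S : Type) (A : set S) (f : S -> R) (x : S) :
  [bounded f x | x in A] -> A x -> `|f x| <= supnorm A f.
Proof.
move=> [K [_ fK]] Ax; apply: ub_le_sup; last by exists x.
exists (K + 1) => _ [y Ay <-].
by apply: fK; rewrite ?ltrDl.
Qed.

Lemma bounded_le (R : realType) (S : Type) (A : set S) (f : S -> R) (K : R) :
  (forall x, A x -> `|f x| <= K) -> [bounded f x | x in A].
Proof.
move=> fK; exists K; split; first exact: num_real.
by move=> K' /ltW KK' x Ax; apply: le_trans KK'; exact: fK.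
Qed.

(** The Nash estimate in the form used for the comparison: any initial time [s], any bound [K] of
    the initial values, ordered times, arbitrary representatives [y1] and [y2] of the torus points.
    The constant is the same for all sides [M.+1]. *)
Definition nash_bound (R : realType) (n : nat) (cm cp sigma C : R) : Prop :=
  forall (M : nat) (a : R -> torus n M -> dir n -> R)
    (v : R -> torus n M -> R) (s K : R),
  (forall t, conductance (@torus_proj n M) cm cp (a t)) ->
  (forall x e, continuous (fun t => a t x e)) ->
  (forall (t : R) x, s <= t ->
     is_derive t 1 (v ^~ x) (Lop (@torus_proj n M) M.+1 (a t) (v t) x)) ->
  (forall x, `|v s x| <= K) ->
  forall (t1 t2 : R) (y1 y2 : 'rV[int]_n), s < t1 -> t1 <= t2 ->
  `|v t1 (torus_proj M y1) - v t2 (torus_proj M y2)| <=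
    C * K * (Num.max (Num.sqrt (t2 - t1))
      (enorm (mesh R M.+1 y1 - mesh R M.+1 y2)) / Num.sqrt (t1 - s)) `^ sigma.

(** The projection is additive, so a torus solution composed with it and shifted to initial time 0
    solves the equation on Z^n. The maximum principle on the torus makes this lift bounded. *)
Lemma nash_exponent_torus (R : realType) (n : nat) (cm cp sigma : R) :
  0 < cm -> nash_exponent n cm cp sigma ->
  exists2 C : R, 0 <= C & nash_bound n cm cp sigma C.
Proof.
(* The given constant may be negative; the maximum with 0 allows the sup norm to be enlarged to
   [K]. *)
move=> cm0 [_ [C HC]]; exists (Num.max C 0); first by rewrite le_max lexx orbT.
move=> M a v s K ha ca v' vK t1 t2 y1 y2 st1 t12.
have K0 : 0 <= K by apply: le_trans (vK 0).
pose a' (t : R) (z : 'rV[int]_n) := a (s + t) (torus_proj M z).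
pose u (t : R) (z : 'rV[int]_n) := v (s + t) (torus_proj M z).
have shift_cont : continuous (fun t : R => s + t).
  by move=> t; apply: cvgD; [exact: cvg_cst|exact: cvg_id].
have u' (t : R) z : 0 <= t -> is_derive t 1 (u ^~ z) (Lop id M.+1 (a' t) (u t) z).
  move=> t0; have st : s <= s + t by rewrite lerDl.
  have d : is_derive t 1 (fun t : R => s + t) 1.
    by apply: is_derive_eq; rewrite add0r mulr1.
  have := @is_derive1_comp R (v ^~ (torus_proj M z)) (fun t => s + t) t _ _
    (v' _ _ st) d.
  rewrite mulr1.
  have -> // : Lop (@torus_proj n M) M.+1 (a (s + t)) (v (s + t)) (torus_proj M z) =
    Lop id M.+1 (a' t) (u t) z.
  rewrite /Lop; congr (_ * _); apply: eq_bigr => e _.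
  by rewrite /u/= torus_projD.
have u_cont z : {within `[0, +oo[, continuous (u ^~ z)}.
  apply: continuous_in_subspaceT => t; rewrite inE/= in_itv/= andbT => t0.
  exact: is_derive_continuous (u' _ z t0).
have uK t z : 0 <= t -> `|u t z| <= K.
  move=> t0; apply: (@lattice_max_principle _ _ _ _ M.+1 cm cp cm0
    (@torus_proj_dir_opp n M) a v s K) => //.
  by rewrite lerDl.
have supK : supnorm setT (u 0) <= K.
  by apply: supnorm_le => [|z _]; [exists 0|exact: uK].
have sup0 : 0 <= supnorm setT (u 0).
  apply: le_trans (@le_supnorm _ _ setT (u 0) 0 _ _) => //.
  by apply: (@bounded_le _ _ _ _ K) => z _; exact: uK.
have -> : v t1 (torus_proj M y1) = u (t1 - s) y1 by rewrite /u addrC subrK.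
have -> : v t2 (torus_proj M y2) = u (t2 - s) y2 by rewrite /u addrC subrK.
apply: le_trans (HC M.+1 a' u erefl _ _ _ _ _ _ y1 y2 _ _) _.
- move=> t _ z e; have [aE ac] := ha (s + t) (torus_proj M z) e.
  by split; [rewrite /a' aE torus_projD|].
- move=> z e; apply: continuous_subspaceT => t.
  apply: (@continuous_comp _ _ _ (fun t => s + t) (fun t => a t (torus_proj M z) e)).
    exact: shift_cont.
  exact: ca.
- split; first exact: u_cont.
  move=> t z; rewrite interior_itv_bndy/= in_itv/= andbT => t0.
  by rewrite addr0; apply: u'; exact: ltW.
- apply: (@bounded_le _ _ _ _ K) => -[t z] [/=].
  by rewrite in_itv/= andbT => t0 _; exact: uK.
- by rewrite subr_gt0.
- by rewrite subr_gt0; exact: lt_le_trans t12.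
have -> : t1 - s - (t2 - s) = - (t2 - t1) by ring.
rewrite normrN ger0_norm ?subr_ge0// (@min_idPl _ _ (t1 - s) _ _); last first.
  by rewrite lerD2r.
apply: ler_wpM2r; first exact: powR_ge0.
apply: le_trans (_ : Num.max C 0 * supnorm setT (u 0) <= _).
  by apply: ler_wpM2r => //; rewrite le_max lexx.
by apply: ler_wpM2l => //; rewrite le_max lexx orbT.
Qed.

(** * Comparison along backward solutions *)

(** For [b = 1 - sigma / 2] the derivative carries the singularity of the Nash bound at [t1], of
    order [- sigma / 2]. *)
Lemma powR_primitive (R : realType) (c b t1 s : R) : b != 0 -> s < t1 ->
  is_derive s 1 (fun s => - (c / b * (t1 - s) `^ b)) (c * (t1 - s) `^ (b - 1)).
Proof.
move=> b0 st.
have d : is_derive s 1 (fun s : R => t1 - s) (- 1).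
  by apply: is_derive_eq; rewrite add0r mul1r.
have ts : 0 < t1 - s by rewrite subr_gt0.
have d2 := @is_derive1_comp R (fun x => x `^ b) (fun s => t1 - s) s _ _
  (is_derive1_powR b ts) d.
have d3 := is_deriveN (is_deriveZ (c / b) d2).
apply: (is_derive_eq d3).
by rewrite /GRing.scale/=; field.
Qed.

Lemma powR_primitive_continuous (R : realType) (c b t1 : R) : 0 < b -> 0 < t1 ->
  {within `[0, t1], continuous (fun s => - (c / b * (t1 - s) `^ b))}.
Proof.
move=> b0 t10.
have cont s : s < t1 -> {for s, continuous (fun s => - (c / b * (t1 - s) `^ b))}.
  by move=> st; apply: is_derive_continuous (powR_primitive _ _ st); rewrite gt_eqF.
apply/continuous_within_itvP => //; split.
- by move=> s; rewrite in_itv/= => /andP[_ st]; exact: cont.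
- by apply: cvg_at_right_filter; exact: cont.
(* At [t1] the slope may be infinite, so continuity is checked directly: [t1 - s < e]^
   b^-1[gives](t1 - s) [^ b < e]. *)
- rewrite subrr powR0 ?gt_eqF// mulr0.
  rewrite -(mulr0 (c / b)); apply: cvgN; apply: cvgMr.
  apply/cvgrPdist_lt => e e0; near=> s.
  have st : s < t1 by near: s; exact: nbhs_left_lt.
  have ts : 0 < t1 - s by rewrite subr_gt0.
  have se : t1 - s < e `^ b^-1.
    rewrite ltrBlDr -ltrBlDl; near: s; apply: nbhs_left_gt.
    by rewrite ltrBlDr ltrDl powR_gt0.
  rewrite sub0r normrN ger0_norm ?powR_ge0//.
  have := gt0_ltr_powR b0 _ _ se; rewrite -powRrM mulVf ?gt_eqF// powRr1 ?ltW//.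
  by apply; rewrite nnegrE ltW// powR_gt0.
Unshelve. all: by end_near. Qed.

(** The function is extended by its end values beyond [[0, T]]. This provides conductances
    continuous on the whole line, as the existence lemmas require. *)
Lemma itv_clamp_continuous (R : realType) (T : R) (f : R -> R) : 0 < T ->
  {within `[0, T], continuous f} ->
  continuous (fun t => f (Num.max (Num.min t T) 0)).
Proof.
move=> T0 cf t; pose cl (t : R) : R := Num.max (Num.min t T) 0.
have clT s : `[0, T]%classic (cl s).
  by rewrite /= in_itv/= le_max lexx orbT/= ge_max (ltW T0) andbT ge_min lexx orbT.
have cl_cont : cl @ t --> cl t.
  apply: (@continuous_max _ _ (fun t => Num.min t T) (cst 0)); last exact: cvg_cst.
  by apply: (@continuous_min _ _ id (cst T)); [exact: cvg_id|exact: cvg_cst].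
have cft : f @ within `[0, T] (nbhs (cl t)) --> f (cl t).
  have := cf (cl t); rewrite /continuous_at.
  by rewrite nbhs_subspace_in.
apply: (@cvg_comp _ _ _ cl f _ (within `[0, T] (nbhs (cl t)))) => //.
move=> P /cl_cont clP.
have {}clP : \forall s \near t, `[0, T]%classic (cl s) -> P (cl s) by exact: clP.
by apply: filterS clP => s; apply; exact: clT.
Qed.

(** Solving the inequality for [e] gives a common lower bound of [S], hence a lower bound of its
    infimum. The power can be inverted once [K] and [K^-1 * A - c] are positive; the other cases are
    immediate. *)
Lemma le_inf_powR (R : realType) (S : set R) (A K c b : R) :
  S !=set0 -> (forall e, S e -> 0 <= e) -> 0 <= A -> 0 <= K -> 0 <= c -> 0 < b ->
  (forall e, S e -> A <= K * (c + e `^ b)) -> A <= K * (c + inf S `^ b).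
Proof.
move=> [e0 Se0] Spos A0; rewrite le_eqVlt => /predU1P[<-|K0] c0 b0 HA.
  by have := HA _ Se0; rewrite !mul0r.
rewrite -ler_pdivrMl// -lerBlDl.
have [B0|B0] := leP (K^-1 * A - c) 0; first by apply: le_trans B0 _; exact: powR_ge0.
have BE : K^-1 * A - c = ((K^-1 * A - c) `^ b^-1) `^ b.
  by rewrite -powRrM mulVf ?gt_eqF// powRr1// ltW.
have infS : (K^-1 * A - c) `^ b^-1 <= inf S.
  apply: lb_le_inf; first by exists e0.
  move=> e Se; have := HA _ Se; rewrite -ler_pdivrMl// -lerBlDl => h.
  have -> : e = (e `^ b) `^ b^-1.
    by rewrite -powRrM mulfV ?gt_eqF// powRr1//; exact: Spos.
  apply: ge0_ler_powR => //; first by rewrite invr_ge0 ltW.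
  - by rewrite nnegrE ltW.
  - by rewrite nnegrE powR_ge0.
rewrite BE; apply: ge0_ler_powR => //; first exact: ltW.
- by rewrite nnegrE powR_ge0.
- by rewrite nnegrE; apply: le_trans infS; exact: powR_ge0.
Qed.

(** The three terms bound, in order, the difference of the two pairings at time 0, its change over
    [[0, t1]], and the change of the second pairing alone over [[t1, t2]]. *)
Lemma torus_holder_ordered (R : realType) (n M : nat) (cm cp T sigma C G U : R)
    (a : R -> torus n M -> dir n -> R) (g u : R -> torus n M -> R)
    (t1 t2 : R) (y1 y2 : 'rV[int]_n) :
  0 < cm -> 0 <= cp -> 0 < sigma < 1 -> 0 <= C -> nash_bound n cm cp sigma C ->
  (forall t, conductance (@torus_proj n M) cm cp (a t)) ->
  (forall x e, continuous (fun t => a t x e)) ->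
  (forall t x, 0 <= t <= T -> `|g t x| <= G) ->
  (forall x, `|u 0 x| <= U) ->
  solves (@torus_proj n M) M.+1 `[0, T] a g u ->
  0 < t1 -> t1 <= t2 -> t2 <= T ->
  `|u t1 (torus_proj M y1) - u t2 (torus_proj M y2)| <=
    C * U * (Num.max (Num.sqrt (t2 - t1))
      (enorm (mesh R M.+1 y1 - mesh R M.+1 y2)) / Num.sqrt t1) `^ sigma
    + 2 * C * G * Num.max (Num.sqrt (t2 - t1))
      (enorm (mesh R M.+1 y1 - mesh R M.+1 y2)) `^ sigma * t1 `^ (1 - sigma / 2)
    + G * (t2 - t1).
Proof.
move=> cm0 cp0 /andP[s0 s1] C0 HC ha ca gG uU [cu u'] t10 t12 t2T.
set m := Num.max _ _.
set x1 := torus_proj M y1; set x2 := torus_proj M y2.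
have pN := @torus_proj_dir_opp n M.
have G0 : 0 <= G.
  by apply: le_trans (gG 0 0 _); rewrite ?normr_ge0// lexx (le_trans (ltW t10))// (le_trans t12).
have m0 : 0 <= m by rewrite le_max sqrtr_ge0.
have delta_le (x0 x : torus n M) : `|(x == x0)%:R : R| <= 1.
  by case: (x == x0); rewrite ?normr1 ?normr0.
have [q1 [q1E q1']] := lattice_backward_solution M.+1 cm0 t1 cp0 ha ca (delta_le x1).
have [q2 [q2E q2']] := lattice_backward_solution M.+1 cm0 t2 cp0 ha ca (delta_le x2).
(* By duality the two sums are the values at (t1, x1) and (t2, x2) of the forward
   homogeneous solution started from [f] at time [s]. *)
have fwd s (f : torus n M -> R) K : (forall x, `|f x| <= K) ->
    (s < t1 -> `|\sum_x q1 s x * f x - \sum_x q2 s x * f x|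
                 <= C * K * (m / Num.sqrt (t1 - s)) `^ sigma) /\
    (s <= t2 -> `|\sum_x q2 s x * f x| <= K).
  move=> fK; have [v [vE v']] := lattice_solution M.+1 cm0 s cp0 ha ca fK.
  have vK x : `|v s x| <= K by rewrite vE.
  have E1 := lattice_duality pN ha q1E q1' v'.
  have E2 := lattice_duality pN ha q2E q2' v'.
  rewrite vE in E1 E2; split => [st1|st2].
    rewrite E1 ?E2 ?(ltW st1)//; first exact: (HC M a v s K).
    exact/ltW/(lt_le_trans st1).
  by rewrite E2//; exact: (lattice_max_principle cm0 pN ha v' vK).
have uD t x : 0 < t < T ->
    is_derive t 1 (u ^~ x) (Lop (@torus_proj n M) M.+1 (a t) (u t) x + g t x).
  by move=> t0T; apply: u'; rewrite interior_itv_bnd/= in_itv.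
have t20 : 0 < t2 by exact: lt_le_trans t12.
have t1T : t1 <= T by exact: le_trans t2T.
have S_cont (q : R -> torus n M -> R) r : r <= T ->
    (forall (t : R) x, t <= r -> is_derive t 1 (q ^~ x)
       (- Lop (@torus_proj n M) M.+1 (a t) (q t) x)) ->
    {within `[0, r], continuous (fun s => \sum_x q s x * u s x)}.
  move=> rT q'.
  apply: (@sum_continuous R (subspace `[0, r]) _ _ (fun x s => q s x * u s x)) => x.
  have c1 : {within `[0, r], continuous (q ^~ x)}.
    apply: continuous_in_subspaceT => s; rewrite inE/= in_itv/= => /andP[_ sr].
    exact: is_derive_continuous (q' _ x sr).
  have c2 : {within `[0, r], continuous (u ^~ x)}.
    apply: continuous_subspaceW (cu x) => s; rewrite /= !in_itv/= => /andP[-> sr].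
    exact: le_trans sr _.
  by move=> s; apply: cvgM; [exact: c1|exact: c2].
have S' (q : R -> torus n M -> R) r : r <= T ->
    (forall (t : R) x, t <= r -> is_derive t 1 (q ^~ x)
       (- Lop (@torus_proj n M) M.+1 (a t) (q t) x)) ->
    forall s, 0 < s < r ->
    is_derive s 1 (fun s => \sum_x q s x * u s x) (\sum_x q s x * g s x).
  move=> rT q' s /andP[s_gt0 sr].
  apply: (lattice_pairing_derive pN (ha s)) => x; first by apply: q'; exact: ltW.
  by apply: uD; rewrite s_gt0 (lt_le_trans sr).
have S_end (q : R -> torus n M -> R) r x0 : q r = (fun x => (x == x0)%:R) ->
    \sum_x q r x * u r x = u r x0.
  move=> ->; rewrite (bigD1 x0)//= eqxx mul1r big1 ?addr0// => x /negbTE ->.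
  by rewrite mul0r.
pose S1 s := \sum_x q1 s x * u s x.
pose S2 s := \sum_x q2 s x * u s x.
have S1_cont : {within `[0, t1], continuous S1} := S_cont _ _ t1T q1'.
have S2_cont : {within `[0, t2], continuous S2} := S_cont _ _ t2T q2'.
have S1' := S' _ _ t1T q1'; have S2' := S' _ _ t2T q2'.
have S1t1 : S1 t1 = u t1 x1 := S_end _ _ _ q1E.
have S2t2 : S2 t2 = u t2 x2 := S_end _ _ _ q2E.
have gsG s x : 0 < s < t2 -> `|g s x| <= G.
  by move=> /andP[s_gt0 st2]; apply: gG; rewrite (ltW s_gt0) (le_trans (ltW st2)).
(* The exponent [- sigma / 2] is written as [b - 1] with [b = 1 - sigma / 2], to match
   [powR_primitive]. *)
have powV s : s < t1 ->
    (m / Num.sqrt (t1 - s)) `^ sigma = m `^ sigma * (t1 - s) `^ (1 - sigma / 2 - 1).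
  move=> st1; rewrite powRM ?invr_ge0//; congr (_ * _).
  have ts : 0 <= t1 - s by rewrite subr_ge0 ltW.
  rewrite -powR12_sqrt// -powRN -powRrM; congr (_ `^ _).
  by field.
have step0 : `|S1 0 - S2 0| <= C * U * (m / Num.sqrt t1) `^ sigma.
  by have [/(_ t10)] := fwd 0 (u 0) U uU; rewrite subr0.
have b0 : 0 < 1 - sigma / 2 by lra.
have step1 : `|(S1 t1 - S2 t1) - (S1 0 - S2 0)| <=
    C * G * m `^ sigma / (1 - sigma / 2) * t1 `^ (1 - sigma / 2).
  pose H s := - (C * G * m `^ sigma / (1 - sigma / 2) * (t1 - s) `^ (1 - sigma / 2)).
  have -> : C * G * m `^ sigma / (1 - sigma / 2) * t1 `^ (1 - sigma / 2) = H t1 - H 0.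
    by rewrite /H subrr subr0 powR0 ?gt_eqF// mulr0 oppr0 opprK add0r.
  apply: (@mean_value_bound _ (fun s => S1 s - S2 s) H
    (fun s => \sum_x q1 s x * g s x - \sum_x q2 s x * g s x)
    (fun s => C * G * m `^ sigma * (t1 - s) `^ (1 - sigma / 2 - 1)) 0 t1 (ltW t10)).
  - move=> s /andP[s_gt0 st1]; apply: is_deriveB.
      by apply: S1'; rewrite s_gt0.
    by apply: S2'; rewrite s_gt0 (lt_le_trans st1).
  - by move=> s /andP[_ st1]; apply: powR_primitive => //; rewrite gt_eqF.
  - move=> s /andP[s_gt0 st1]; rewrite -mulrA -powV//.
    apply: (proj1 (fwd s (g s) G _)) => // x.
    by apply: gsG; rewrite s_gt0 (lt_le_trans st1).
  - have S2_cont1 : {within `[0, t1], continuous S2}.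
      apply: continuous_subspaceW S2_cont => s; rewrite /= !in_itv/= => /andP[-> st].
      exact: le_trans t12.
    by move=> s; apply: cvgB; [exact: S1_cont|exact: S2_cont1].
  - exact: powR_primitive_continuous.
(* After [t1] only [S2] evolves; the maximum principle bounds its derivative by [G]. *)
have step2 : `|S2 t2 - S2 t1| <= G * (t2 - t1).
  rewrite mulrBr.
  apply: (@mean_value_bound _ S2 (fun s => G * s)
    (fun s => \sum_x q2 s x * g s x) (fun=> G) t1 t2 t12).
  - by move=> s /andP[st1 st2]; apply: S2'; rewrite (lt_trans t10)// st2.
  - by move=> s _; apply: is_derive_eq; rewrite /GRing.scale/= mulr1.
  - move=> s /andP[st1 st2]; apply: (proj2 (fwd s (g s) G _)); last exact: ltW.
    by move=> x; apply: gsG; rewrite (lt_trans t10)// st2.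
  - apply: continuous_subspaceW S2_cont => s; rewrite /= !in_itv/= => /andP[st ->].
    by rewrite (le_trans (ltW t10)).
  - apply: continuous_subspaceT => s; apply: cvgM; first exact: cvg_cst.
    exact: cvg_id.
(* Since [sigma < 1], dividing by [1 - sigma / 2] costs at most a factor 2. *)
have le2 : C * G * m `^ sigma / (1 - sigma / 2) * t1 `^ (1 - sigma / 2) <=
    2 * C * G * m `^ sigma * t1 `^ (1 - sigma / 2).
  apply: ler_wpM2r; first exact: powR_ge0.
  rewrite ler_pdivrMr//.
  have X0 : 0 <= C * G * m `^ sigma by rewrite !mulr_ge0 ?powR_ge0.
  rewrite -!(mulrA 2) !mulrA -!(mulrA 2) in X0 *.
  by move: (C * G * m `^ sigma) X0 => X X0; nra.
rewrite -S1t1 -S2t2.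
have -> : S1 t1 - S2 t2 = (S1 0 - S2 0) + ((S1 t1 - S2 t1) - (S1 0 - S2 0))
   - (S2 t2 - S2 t1) by ring.
apply: le_trans (ler_normB _ _) _; apply: lerD step2.
apply: le_trans (ler_normD _ _) _; apply: lerD step0 _.
exact: le_trans step1 le2.
Qed.

(** Put [p = t1]^ (sigma / 2)[. In the second term]t1 [^ (1 - sigma / 2) = t1 / p <= T / p]; in the
    third, [d] splits into powers [1 - sigma / 2] and [sigma / 2], and the first of these times [p]
    is at most [T]. The three terms contribute [C], [2 * C * T] and [T] to the constant. *)
Lemma holder_terms_le (R : realType) (C G U T sigma t1 d e : R) :
  0 < sigma < 1 -> 0 <= C -> 0 <= G -> 0 <= U -> 0 < t1 <= T -> 0 <= d <= T ->
  0 <= e ->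
  C * U * (Num.max (Num.sqrt d) e / Num.sqrt t1) `^ sigma
    + 2 * C * G * Num.max (Num.sqrt d) e `^ sigma * t1 `^ (1 - sigma / 2) + G * d
  <= (C * (1 + 2 * T) + T) * (G + U)
     * ((d `^ (sigma / 2) + e `^ sigma) / t1 `^ (sigma / 2)).
Proof.
move=> /andP[s0 s1] C0 G0 U0 /andP[t10 t1T] /andP[d0 dT] e0.
set m := Num.max _ _.
have T0 : 0 <= T by exact: le_trans dT.
have m0 : 0 <= m by rewrite le_max sqrtr_ge0.
have sqrt_pow x : 0 <= x -> Num.sqrt x `^ sigma = x `^ (sigma / 2).
  by move=> x0; rewrite -powR12_sqrt// -powRrM mulrC.
have pow_split x : 0 <= x -> x `^ (1 - sigma / 2) * x `^ (sigma / 2) = x.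
  move=> x0; rewrite -powRD ?subrK ?powRr1//.
  by rewrite oner_eq0.
have st0 : 0 <= sigma / 2 by lra.
have sb0 : 0 <= 1 - sigma / 2 by lra.
set D := d `^ (sigma / 2) + e `^ sigma.
have D0 : 0 <= D by rewrite addr_ge0 ?powR_ge0.
have mD : m `^ sigma <= D.
  rewrite /m /D -sqrt_pow//.
  have [_|_] := leP (Num.sqrt d) e; first by rewrite lerDr powR_ge0.
  by rewrite lerDl powR_ge0.
set p := t1 `^ (sigma / 2); have p0 : 0 < p by exact: powR_gt0.
have E1 : (m / Num.sqrt t1) `^ sigma <= D / p.
  rewrite powRM ?invr_ge0//.
  have -> : (Num.sqrt t1)^-1 `^ sigma = p^-1.
    by rewrite -(powR_inv1 (sqrtr_ge0 t1)) powRAC powR_inv1 ?powR_ge0// sqrt_pow// ltW.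
  by apply: ler_wpM2r => //; rewrite invr_ge0 ltW.
have E2 : m `^ sigma * t1 `^ (1 - sigma / 2) <= T * (D / p).
  rewrite mulrA ler_pdivlMr// -mulrA pow_split ?(ltW t10)// mulrC.
  by apply: ler_pM => //; [exact: ltW|exact: powR_ge0].
have E3 : d <= T * (D / p).
  have dD : d `^ (sigma / 2) <= D by rewrite lerDl powR_ge0.
  have dT' : d `^ (1 - sigma / 2) * p <= T.
    rewrite -[leRHS](pow_split T T0); apply: ler_pM; rewrite ?powR_ge0//.
      by apply: ge0_ler_powR.
    by apply: ge0_ler_powR; rewrite // nnegrE ltW.
  rewrite mulrA ler_pdivlMr// -{1}(pow_split d d0) mulrAC.
  by apply: ler_pM; rewrite ?mulr_ge0 ?powR_ge0// ltW.
have X0 : 0 <= D / p by rewrite divr_ge0// ltW.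
move: (D / p) X0 E1 E2 E3 => X X0 E1 E2 E3.
have h1 : C * U * (m / Num.sqrt t1) `^ sigma <= C * U * X.
  by apply: ler_wpM2l => //; rewrite mulr_ge0.
have h2 : 2 * C * G * m `^ sigma * t1 `^ (1 - sigma / 2) <= 2 * C * G * (T * X).
  by rewrite -mulrA; apply: ler_wpM2l => //; rewrite !mulr_ge0.
have h3 : G * d <= G * (T * X) by apply: ler_wpM2l.
apply: le_trans (lerD (lerD h1 h2) h3) _.
have p1 : 0 <= C * G * X by rewrite !mulr_ge0.
have p2 : 0 <= C * T * U * X by rewrite !mulr_ge0.
have p3 : 0 <= T * U * X by rewrite !mulr_ge0.
lra.
Qed.

(** * Unordered times and the infimum over representatives *)

Theorem theorem2p2 (R : realType) (n : nat) (cm cp T sigma : R)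
    (hn : (0 < n)%N) (hcm : 0 < cm) (hcp : cm < cp) (hT : 0 < T)
    (hsigma : nash_exponent n cm cp sigma) :
  exists C : R,
  forall (M : nat) (a : R -> torus n M -> dir n -> R)
         (g u : R -> torus n M -> R),
  (forall t, 0 <= t <= T -> conductance (@torus_proj n M) cm cp (a t)) ->
  (forall x e, {within `[0, T], continuous (fun t => a t x e)}) ->
  [bounded g q.1 q.2 | q in `[0, T] `*` setT] ->
  (forall x, {within `[0, T], continuous (fun t => g t x)}) ->
  [bounded u 0 x | x in setT] ->
  solves (@torus_proj n M) M.+1 `[0, T] a g u ->
  forall (t1 t2 : R) (x1 x2 : torus n M), 0 < t1 <= T -> 0 < t2 <= T ->
  `|u t1 x1 - u t2 x2| <=
    C * (supnorm (`[0, T] `*` setT) (fun q => g q.1 q.2) + supnorm setT (u 0))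
      * ((`|t2 - t1| `^ (sigma / 2) + torus_dist R x1 x2 `^ sigma)
         / Num.min t1 t2 `^ (sigma / 2)).
Proof.
have [s01 _] := hsigma; have /andP[s0 s1] := s01.
have [C C0 HC] := nash_exponent_torus hcm hsigma.
have cp0 : 0 <= cp by exact: ltW (lt_trans hcm hcp).
exists (C * (1 + 2 * T) + T) => M a g u ha ca gb _ ub [cu u'] t1 t2 x1 x2 ht1 ht2.
set G := supnorm _ _; set U := supnorm setT (u 0).
have gG t x : 0 <= t <= T -> `|g t x| <= G.
  by move=> tT; apply: (le_supnorm (x := (t, x)) gb); split => //=; rewrite in_itv.
have uU x : `|u 0 x| <= U by exact: le_supnorm ub _.
have G0 : 0 <= G by apply: le_trans (gG 0 x1 _) => //; rewrite lexx ltW.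
have U0 : 0 <= U by apply: le_trans (uU x1).
(* The hypotheses on [a] concern [[0, T]] only. Clamping the time extends them to the line and
   leaves the equation intact, being the identity in the interior. *)
pose cl (t : R) : R := Num.max (Num.min t T) 0.
have clT t : 0 <= cl t <= T.
  by rewrite le_max lexx orbT/= ge_max (ltW hT) andbT ge_min lexx orbT.
have clE t : 0 < t < T -> cl t = t.
  by move=> /andP[t0 tT]; rewrite /cl (min_idPl (ltW tT)) (max_idPl (ltW t0)).
have sol : solves (@torus_proj n M) M.+1 `[0, T] (fun t => a (cl t)) g u.
  split=> // t x tT; rewrite clE; first exact: u'.
  by move: tT; rewrite interior_itv_bnd/= in_itv.
have cla t : conductance (@torus_proj n M) cm cp (a (cl t)) by exact: ha.
have clc x e : continuous (fun t => a (cl t) x e).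
  exact: (itv_clamp_continuous hT (ca x e)).
have main y1 y2 r1 r2 : 0 < r1 <= T -> 0 < r2 <= T -> r1 <= r2 ->
    `|u r1 (torus_proj M y1) - u r2 (torus_proj M y2)| <=
    (C * (1 + 2 * T) + T) * (G + U) * ((`|r2 - r1| `^ (sigma / 2)
      + enorm (mesh R M.+1 y1 - mesh R M.+1 y2) `^ sigma)
      / Num.min r1 r2 `^ (sigma / 2)).
  move=> /andP[r10 r1T] /andP[r20 r2T] r12.
  rewrite (min_idPl r12) (@ger0_norm _ (r2 - r1)) ?subr_ge0//.
  apply: le_trans (holder_terms_le s01 C0 G0 U0 _ _ _); last 3 first.
  - by rewrite r10.
  - by rewrite subr_ge0 r12 lerBlDr (le_trans r2T)// lerDl ltW.
  - exact: sqrtr_ge0.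
  exact: (torus_holder_ordered _ _ hcm cp0 s01 C0 HC cla clc gG uU sol r10 r12 r2T).
have {}main y1 y2 : `|u t1 (torus_proj M y1) - u t2 (torus_proj M y2)| <=
    (C * (1 + 2 * T) + T) * (G + U) * ((`|t2 - t1| `^ (sigma / 2)
      + enorm (mesh R M.+1 y1 - mesh R M.+1 y2) `^ sigma)
      / Num.min t1 t2 `^ (sigma / 2)).
  (* The bound is symmetric in the two space-time points, so the times may be ordered. *)
  have [t12|t21] := orP (le_total t1 t2); first exact: main.
  have := main y2 y1 t2 t1 ht2 ht1 t21.
  by rewrite [X in X <= _]distrC (distrC t1) enormC minC.
(* Moving the denominator into the constant gives the shape of [le_inf_powR]. The lift of [x1] stays
   fixed while the representative of [x2] varies. *)
rewrite mulrA mulrAC.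
apply: le_inf_powR => //.
- exists (enorm (mesh R M.+1 (torus_lift x1) - mesh R M.+1 (torus_lift x2))).
  by exists (torus_lift x2) => //=; rewrite torus_liftK.
- by move=> _ [z _ <-]; exact: sqrtr_ge0.
- have T0 := ltW hT.
  by rewrite divr_ge0 ?powR_ge0// mulr_ge0 ?addr_ge0// mulr_ge0// addr_ge0// mulr_ge0.
- move=> _ [z /= zE <-].
  have := main (torus_lift x1) z; rewrite torus_liftK zE.
  by rewrite mulrA mulrAC.
Qed.
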